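(* Let $k\ge 2$, let $\sigma=\underline{\sigma_1\sigma_2\cdots\sigma_{k-1}}$ be any consecutive pattern on $\{1,2,\ldots,k-1\}$, and let $p=\sigma k=\underline{\sigma_1\cdots\sigma_{k-1}}k$ be the corresponding quasi-consecutive pattern of length $k$ ending with its largest element. Then $$A^p(x,t)=\frac{1}{t}\left(e^{t\int_0^x A^{\sigma}(y,t)\,dy}-1\right)+1 .$$
   Context: Let $\mathfrak{S}_n$ be the set of permutations of $\{1,\ldots,n\}$ in one-line notation $\pi=\pi_1\cdots\pi_n$ ($\mathfrak{S}_0$ consists of the empty permutation only). $\mathrm{std}$ denotes standardization: replace the $i$-th smallest letter by $i$. The descent number is $\mathrm{des}(\pi)=|\{i\in[n-1]:\pi_i>\pi_{i+1}\}|$. A vincular pattern $\omega$ of length $k$ is a permutation in $\mathfrak{S}_k$ some of whose consecutive letters may be underlined. An occurrence of $\omega$ in $\pi$ is a subsequence $\pi_{i_1}\cdots\pi_{i_k}$ ($i_1<\cdots<i_k$) whose standardization is $\omega$, such that letters corresponding to a block of letters underlined together occupy adjacent positions in $\pi$. $\pi$ avoids $\omega$ if it has no occurrence of $\omega$; $\mathfrak{S}_n(\omega)$ is the set of $\omega$-avoiding permutations in $\mathfrak{S}_n$. A consecutive pattern is one in which all letters are underlined together (so its occurrences are at adjacent positions). In $p=\sigma k$ the first $k-1$ letters must be adjacent in an occurrence, while there is no adjacency condition on the last letter. $A_n^{\omega}(t)=\sum_{\pi\in\mathfrak{S}_n(\omega)}t^{\mathrm{des}(\pi)}$, with $A_0^{\omega}(t)=1$,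 and $A^{\omega}(x,t)=\sum_{n\ge 0}A_n^{\omega}(t)\frac{x^n}{n!}$. Identities are between formal power series in $x$ (integration in $y$ is termwise). *)

(* Defs.v *)
From mathcomp Require Import all_boot all_order all_fingroup all_algebra.

Set Implicit Arguments.
Unset Strict Implicit.
Unset Printing Implicit Defensive.

Import GRing.Theory.

(* An element of 'S_n permutes {0, ..., n-1}; the letter of the paper's
   permutation of {1, ..., n} at 0-based position i is (s i).+1. *)
Definition oneline n (s : 'S_n) : seq nat := [seq (s i).+1 | i <- enum 'I_n].

(* On a word with distinct letters, the number of letters <= x is the rank
   (starting from 1) of x. *)
Definition std (w : seq nat) : seq nat := [seq count (fun y => y <= x) w | x <- w].

Definition des n (s : 'S_n) : nat :=
  #|[set i : 'I_n | [exists j : 'I_n, (j == i.+1 :> nat) && (s j < s i)]]|.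

(* vp_under contains i when the letters at (0-based) positions i and i+1 are
   underlined together; whether the last position belongs to it is irrelevant. *)
Record vpattern (k : nat) := VPattern {
  vp_perm : 'S_k;
  vp_under : {set 'I_k}
}.

Definition occurrence k n (w : vpattern k) (s : 'S_n) (f : {ffun 'I_k -> 'I_n}) : bool :=
  [&& [forall a : 'I_k, forall b : 'I_k, (a < b) ==> (f a < f b)],
      std [seq (s (f a)).+1 | a <- enum 'I_k] == oneline (vp_perm w)
    & [forall a in vp_under w, forall b : 'I_k,
         (b == a.+1 :> nat) ==> (f b == (f a).+1 :> nat)]].

Definition avoiders k n (w : vpattern k) : {set 'S_n} :=
  [set s | ~~ [exists f, occurrence w s f]].

Definition consecutive_pattern m (sigma : 'S_m) : vpattern m :=
  VPattern sigma [set: 'I_m].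

(* The letter m+1 is appended to sigma, and the first m letters are underlined
   together. *)
Definition quasi_consecutive_pattern m (sigma : 'S_m) : vpattern m.+1 :=
  VPattern (lift_perm ord_max ord_max sigma) [set i : 'I_m.+1 | i.+1 < m].

Lemma oneline_quasi_consecutive m (sigma : 'S_m) :
  oneline (vp_perm (quasi_consecutive_pattern sigma)) = rcons (oneline sigma) m.+1.
Proof.
rewrite /oneline enum_ordSr map_rcons /= lift_perm_id -map_comp.
congr rcons; apply: eq_map => i /=.
have -> : widen_ord (leqnSn m) i = lift ord_max i.
  by apply: val_inj; rewrite /= /bump leqNgt ltn_ord.
by rewrite lift_perm_lift /= /bump leqNgt ltn_ord.
Qed.

Local Open Scope ring_scope.

Definition A_poly k (w : vpattern k) (n : nat) : {poly rat} :=
  \sum_(s in avoiders n w) 'X^(des s).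

Lemma A_poly0 k (w : vpattern k) : (0 < k)%N -> A_poly w 0 = 1.
Proof.
move=> k_gt0; rewrite /A_poly (big_pred1 1%g) => [|s].
  by rewrite (_ : des _ = 0%N) //; apply: eq_card0 => -[].
rewrite inE [RHS](_ : _ = true); last by apply/eqP/permP => -[].
by apply/existsP => -[f _]; case: (f (Ordinal k_gt0)).
Qed.

(* Formal power series in x: f n is the coefficient of x^n. *)
Definition fps (R : Type) := nat -> R.

Definition fps_const (R : nzRingType) (c : R) : fps R :=
  fun n => if n is 0 then c else 0.

Definition fps_add (R : nzRingType) (f g : fps R) : fps R := fun n => f n + g n.

Definition fps_sub (R : nzRingType) (f g : fps R) : fps R := fun n => f n - g n.

Definition fps_scale (R : nzRingType) (c : R) (f : fps R) : fps R := fun n => c * f n.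

Definition fps_mul (R : nzRingType) (f g : fps R) : fps R :=
  fun n => \sum_(i < n.+1) f i * g (n - i)%N.

Definition fps_pow (R : nzRingType) (f : fps R) (m : nat) : fps R :=
  iter m (fps_mul f) (fps_const 1).

Definition fps_int (K : fieldType) (f : fps K) : fps K :=
  fun n => if n is m.+1 then f m / m.+1%:R else 0.

(* Meaningful when f has zero constant term: then f^m has no terms of degree
   below m, so that the series sum_m f^m / m! truncates as below in degree n. *)
Definition fps_exp (K : fieldType) (f : fps K) : fps K :=
  fun n => \sum_(m < n.+1) fps_pow f m n / (m`!)%:R.

(* The coefficient field Q(t), which contains 1/t. *)
Definition Qt : fieldType := {fraction {poly rat}}.

Definition t : Qt := tofrac 'X.

Definition A_series k (w : vpattern k) : fps Qt :=
  fun n => tofrac (A_poly w n) / (n`!)%:R.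

(* Main.v *)
(** Write a permutation of [1..n] as [pi = alpha n beta].  Then [pi] avoids [p]
    iff [alpha] avoids [sigma] (otherwise [n] completes an occurrence of
    [sigma] to one of [p]) and [beta] avoids [p]; the descents of [pi] are
    those of [alpha] and of [beta], plus one if [beta] is nonempty.  Writing
    [F] and [G] for the two generating functions, this says
    [F' = G (1 + t (F - 1))], a linear equation whose solution with [F(0) = 1]
    is the claimed one.  The binomial coefficients come from averaging over
    [S_i x S_(n-i)] acting on the positions of [alpha] and [beta], so that no
    subsets of letters occur. *)

Require Import Defs.
From mathcomp Require Import all_boot all_order all_fingroup all_algebra.
From mathcomp Require Import zify.

Set Implicit Arguments.
Unset Strict Implicit.
Unset Printing Implicit Defensive.

Import GRing.Theory.

(** * Words, relative order and standardization *)

Local Open Scope nat_scope.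

(* A word of length n is a function on nat of which only the values below n
   matter. *)
Definition word n (s : 'S_n) (x : nat) : nat := oapp (fun i : 'I_n => val (s i)) 0 (insub x).

Lemma word_val n (s : 'S_n) (i : 'I_n) : word s i = s i.
Proof. by rewrite /word valK. Qed.

Lemma wordE n (s : 'S_n) x (ltxn : x < n) : word s x = s (Ordinal ltxn).
Proof. exact: (word_val s (Ordinal ltxn)). Qed.

Lemma ltn_word n (s : 'S_n) x : x < n -> word s x < n.
Proof. by move=> ltxn; rewrite wordE. Qed.

Definition inj_below n (phi : nat -> nat) :=
  forall x y, x < n -> y < n -> phi x = phi y -> x = y.

Lemma word_inj n (s : 'S_n) : inj_below n (word s).
Proof.
move=> x y ltxn ltyn; rewrite !wordE => /val_inj/perm_inj E.
exact: (congr1 val E).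
Qed.

Lemma exists_perm n (c : nat -> nat) :
  (forall x, x < n -> c x < n) -> inj_below n c ->
  exists q : 'S_n, forall i, q i = c i :> nat.
Proof.
move=> ltc injc; pose f (i : 'I_n) := Ordinal (ltc i (ltn_ord i)).
have injf : injective f.
  by move=> x y /(congr1 val)/= /injc E; apply/val_inj/E; rewrite ltn_ord.
by exists (perm injf) => i; rewrite permE.
Qed.

Definition same_order n (phi psi : nat -> nat) :=
  forall x y, x < n -> y < n -> (phi x <= phi y) = (psi x <= psi y).

(** Descents and pattern avoidance depend only on the relative order of letters, so such statistics
    can be evaluated on a subword without standardizing it. *)
Definition order_invariant (T : Type) n (W : (nat -> nat) -> T) :=
  forall phi psi, same_order n phi psi -> W phi = W psi.

Lemma standardization n phi :
  inj_below n phi -> exists r : 'S_n, same_order n (word r) phi.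
Proof.
(* [c x] is the rank, counted from 0, of [phi x] among the first [n] values. *)
move=> injphi; pose c x := \sum_(y < n) (phi y < phi x).
have cE x y : x < n -> phi x < phi y -> c x < c y.
  move=> ltx lt; rewrite /c (bigD1 (Ordinal ltx)) //= [X in _ < X](bigD1 (Ordinal ltx)) //=.
  rewrite lt ltnn add0n add1n ltnS; apply: leq_sum => z _.
  by case: (ltnP (phi z) (phi x)) => // /ltn_trans ->.
have leE x y : x < n -> y < n -> (c x <= c y) = (phi x <= phi y).
  move=> ltx lty; case: (ltngtP (phi x) (phi y)) => [|lt|E].
  - by move=> /cE lt; rewrite ltnW ?lt.
  - by apply/negbTE; rewrite -ltnNge cE.
  - by rewrite (injphi x y) ?leqnn.
have [||r rE] := exists_perm (c := c) (n := n).
- move=> x ltx; rewrite /c (bigD1 (Ordinal ltx)) //= ltnn add0n.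
  apply: (@leq_ltn_trans (\sum_(y < n | y != Ordinal ltx) 1)).
    by apply: leq_sum => z _; case: (_ < _).
  by rewrite sum1_card cardC1 card_ord; case: (n) ltx.
- move=> x y ltx lty E; apply: injphi => //; apply/eqP.
  by rewrite eqn_leq -!leE // E leqnn.
- by exists r => x y ltx lty; rewrite !wordE !rE leE.
Qed.

(** * Averaging over rearrangements of positions *)

Section Averaging.

Variable R : nzRingType.
Local Open Scope ring_scope.

(** If [r] standardizes [phi], then [phi \o word u] has the same relative order as the word of
    [u * r], and right multiplication by [r] permutes ['S_n]. *)
Lemma sum_relabel n (phi : nat -> nat) (W : (nat -> nat) -> R) :
  inj_below n phi -> order_invariant n W ->
  \sum_(u : 'S_n) W (phi \o word u) = \sum_(u : 'S_n) W (word u).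
Proof.
move=> /standardization[r rE] invW.
rewrite [RHS](reindex_inj (mulIg r)) /=; apply: eq_bigr => u _.
apply: invW => x y ltx lty; rewrite -rE ?ltn_word //.
by rewrite !(wordE _ ltx) !(wordE _ lty) !permM -!word_val.
Qed.

(** Right multiplication by [tperm i k] turns the permutations fixing [i] into those sending [i] to
    [k]. *)
Lemma card_perm_at n (i k : 'I_n.+1) : #|[set s : 'S_n.+1 | s i == k]| = n`!.
Proof.
have <- : #|perm_on [set~ i]| = n`!.
  by rewrite card_perm cardsC1 card_ord.
rewrite -[RHS](card_imset _ (mulIg (tperm i k))); apply: eq_card => s.
rewrite inE; apply/eqP/imsetP => [si|[q]].
  exists (s * tperm i k)%g; last by rewrite -mulgA tperm2 mulg1.
  apply/subsetP => x; rewrite !inE; apply: contra => /eqP ->.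
  by rewrite permM si tpermR.
move=> /out_perm qi ->; rewrite permM qi ?tpermL //.
by rewrite !inE eqxx.
Qed.

(** This is the direct sum of [u], a fixed point and [v], used to permute positions on the two sides
    of [i] independently. *)
Lemma block_perm i j (u : 'S_i) (v : 'S_j) n : n = (i + j)%N ->
  exists q : 'S_n.+1, [/\ forall x : 'I_n.+1, x = i :> nat -> q x = x,
    forall x, (x < i)%N -> word q x = word u x &
    forall y, (y < j)%N -> word q (i.+1 + y) = (i.+1 + word v y)%N].
Proof.
move=> def_n.
pose c x := (if x < i then word u x else
             if x == i then i else i.+1 + word v (x - i.+1))%N.
have cu x : (x < i)%N -> c x = word u x by rewrite /c => ->.
have ci : c i = i by rewrite /c ltnn eqxx.
have cv y : c (i.+1 + y)%N = (i.+1 + word v y)%N.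
  rewrite /c ltnNge ifF ?ifF; last by lia.
    by rewrite addKn.
  by lia.
have split x : (x < n.+1)%N ->
    [\/ (x < i)%N, x = i | exists2 y, (y < j)%N & x = (i.+1 + y)%N].
  rewrite def_n => ltx; case: (ltngtP x i) => ?; [exact: Or31| |exact: Or32].
  by apply: Or33; exists (x - i.+1)%N; lia.
have ltu x : (x < i)%N -> (c x < i)%N by move=> ltx; rewrite cu ?ltn_word.
have [||q qE] := exists_perm (c := c) (n := n.+1).
- move=> x; rewrite {2}def_n => /split[ltx|->|[y lty ->]]; rewrite ?ci ?cv.
  + by have := ltu x ltx; lia.
  + by lia.
  + by have := ltn_word v lty; lia.
- move=> x y /split[ltx|->|[x' ltx ->]] /split[lty|->|[y' lty ->]].
  all: rewrite ?ci ?cv ?cu //.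
  + exact: word_inj.
  + by have := ltn_word u ltx; lia.
  + by have := ltn_word u ltx; lia.
  + by have := ltn_word u lty; lia.
  + by lia.
  + by have := ltn_word u lty; lia.
  + by lia.
  + by move/addnI/word_inj=> ->.
exists q; split=> [x xi|x ltx|y lty].
- by apply: val_inj; rewrite [LHS]qE xi ci.
- have lt : (x < n.+1)%N by rewrite def_n; lia.
  by rewrite wordE qE cu.
- have lt : (i.+1 + y < n.+1)%N by rewrite def_n; lia.
  by rewrite wordE qE cv.
Qed.

(* Composing s with a permutation of the positions below i and one of the
   positions above i does not change the left-hand sum; averaging over all such
   pairs lets g and h range over all standardizations independently. *)
Lemma sum_split n (i k : 'I_n.+1) j (g h : (nat -> nat) -> R) :
  n = (i + j)%N -> order_invariant i g -> order_invariant j h ->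
  (\sum_(s : 'S_n.+1 | s i == k)
      g (word s) * h (fun y => word s (i.+1 + y)%N)) *+ (i`! * j`!)%N =
  ((\sum_(u : 'S_i) g (word u)) * (\sum_(v : 'S_j) h (word v))) *+ n`!.
Proof.
move=> def_n invg invh; set S := (X in X *+ _ = _).
have SE (u : 'S_i) (v : 'S_j) : S = \sum_(s : 'S_n.+1 | s i == k)
    g (word s \o word u) * h ((fun y => word s (i.+1 + y)%N) \o word v).
  have [q [qi qu qv]] := block_perm u v def_n.
  (* In [q * s] the positions are moved by [q] before [s] is applied; since [q] fixes [i], the
     condition [s i == k] is preserved. *)
  rewrite /S (reindex_inj (mulgI q)) /=; apply: eq_big => [s|s _].
    by rewrite permM qi.
  have qs x : (x < n.+1)%N -> word (q * s)%g x = word s (word q x).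
    by move=> ltx; rewrite !(wordE _ ltx) permM -word_val.
  congr (_ * _).
    apply: invg => x y ltx lty /=.
    by rewrite !qs ?qu //; lia.
  apply: invh => x y ltx lty /=.
  by rewrite !qs ?qv //; lia.
transitivity (\sum_(u : 'S_i) \sum_(v : 'S_j) S).
  by rewrite !sumr_const -mulrnA !card_Sn mulnC.
transitivity (\sum_(s : 'S_n.+1 | s i == k) \sum_(u : 'S_i) \sum_(v : 'S_j)
    g (word s \o word u) * h ((fun y => word s (i.+1 + y)%N) \o word v)).
  rewrite [RHS]exchange_big; apply: eq_bigr => u _ /=.
  by rewrite [RHS]exchange_big; apply: eq_bigr => v _ /=; exact: SE.
(* By [sum_relabel] the inner double sum is the same for every [s], so the factor [n!] counts the
   admissible [s]. *)
rewrite -(card_perm_at i k) -sumr_const; apply: eq_big => [s|s _]; first by rewrite inE.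
rewrite -(@sum_relabel _ (word s) g) //; last first.
  by move=> x y ltx lty; apply: word_inj; lia.
rewrite -(@sum_relabel _ (fun y => word s (i.+1 + y)%N) h) //; last first.
  by move=> x y ltx lty /word_inj E; apply: (@addnI i.+1); apply: E; lia.
rewrite big_distrl; apply: eq_bigr => u _ /=.
by rewrite big_distrr.
Qed.

End Averaging.

(** * Descents of words *)

Definition word_des n (phi : nat -> nat) : nat := \sum_(x < n.-1) (phi x.+1 < phi x).

Lemma des_word n (s : 'S_n) : des s = word_des n (word s).
Proof.
rewrite /des /word_des; case: n s => [|n] s /=.
  by rewrite big_ord0; apply: eq_card0 => -[].
(* The last position has no successor, hence contributes no descent. *)
rewrite -sum1_card big_mkcond big_ord_recr /= [X in _ + X]ifF; last first.
  apply/negbTE; rewrite inE negb_exists; apply/forallP => j.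
  by rewrite negb_and neq_ltn ltn_ord.
rewrite addn0; apply: eq_bigr => x _; rewrite inE.
have lt1 : x.+1 < n.+1 by have := ltn_ord x; lia.
have lt0 : x < n.+1 by have := ltn_ord x; lia.
rewrite (wordE s lt1) (wordE s lt0).
have -> : widen_ord (leqnSn n) x = Ordinal lt0 by apply: val_inj.
set b := (X in nat_of_bool X).
suff -> : [exists j : 'I_n.+1, (j == x.+1 :> nat) && (s j < s (Ordinal lt0))] = b.
  by case: b.
apply/existsP/idP => [[j /andP[/eqP jx]]|lt].
  by rewrite (_ : j = Ordinal lt1) //; apply: val_inj.
by exists (Ordinal lt1); rewrite eqxx.
Qed.

Lemma word_des_order n : order_invariant n (word_des n).
Proof.
move=> phi psi E; apply: eq_bigr => x _; have := ltn_ord x.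
by rewrite !ltnNge => ltx; rewrite E //; lia.
Qed.

Definition peak_at i n (phi : nat -> nat) :=
  forall x, x < n -> x <> i -> phi x < phi i.

(** The step into the maximum is an ascent and the step out of it, present only when [0 < j], is a
    descent; all other steps stay on one side of [i]. *)
Lemma word_des_peak i j phi : peak_at i (i + j.+1) phi ->
  word_des (i + j.+1) phi =
  word_des i phi + (0 < j) + word_des j (fun y => phi (i.+1 + y)).
Proof.
move=> peak; rewrite /word_des addnS /= big_split_ord /= -addnA; congr (_ + _).
  case: i peak => [|i] peak; first by rewrite !big_ord0.
  rewrite big_ord_recr /= [X in _ + X](_ : _ = 0) ?addn0 //.
  by rewrite ltnNge ltnW // peak; lia.
case: j peak => [|j] peak; first by rewrite !big_ord0.
rewrite big_ord_recl /= addn0 peak ?add1n //; try lia.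
by congr (_.+1); apply: eq_bigr => y _; rewrite /bump /= add1n !addnS !addSn.
Qed.

(** * Pattern occurrences as order conditions on words *)

(** The rank of [g a] is the size of the set of [b] with [g b <= g a]. These sets are nested, so
    equal ranks force equal order; conversely, under equal order the set is the preimage by [sigma]
    of an initial segment. *)
Lemma std_oneline m (sigma : 'S_m) (g : 'I_m -> nat) :
  reflect (forall a b, (g a <= g b) = (sigma a <= sigma b))
    (std [seq (g a).+1 | a <- enum 'I_m] == oneline sigma).
Proof.
have -> : std [seq (g a).+1 | a <- enum 'I_m] =
          [seq #|[set b | g b <= g a]| | a <- enum 'I_m].
  rewrite /std -map_comp; apply: eq_map => a /=.
  by rewrite count_map -sum1_count big_enum_cond -sum1dep_card.
apply: (iffP eqP) => [/eq_in_map E|E].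
  have {}E a : #|[set b | g b <= g a]| = (sigma a).+1 by apply: E; rewrite mem_enum.
  have ltE a b : g a < g b -> sigma a < sigma b.
    move=> lt; rewrite -ltnS -!E; apply/proper_card/properP; split.
      by apply/subsetP => c; rewrite !inE => /leq_trans; apply; apply: ltnW.
    by exists b; rewrite !inE // -ltnNge.
  move=> a b; case: (leqP (g a) (g b)) => [le|/ltE]; last by rewrite ltnNge => /negbTE.
  apply/esym; rewrite -ltnS -!E subset_leq_card //.
  by apply/subsetP => c; rewrite !inE => /leq_trans; apply.
apply: eq_map => a.
rewrite (_ : [set b | _] = sigma @^-1: [set c : 'I_m | c < (sigma a).+1]); last first.
  by apply/setP => b; rewrite !inE E.
rewrite (on_card_preimset (onW_bij _ (injF_bij (@perm_inj _ sigma)))).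
rewrite -sum1dep_card (big_ord_narrow (ltn_ord (sigma a))).
by rewrite sum1_card card_ord.
Qed.

Lemma exists_ffun k n (c : nat -> nat) : (forall a, a < k -> c a < n) ->
  exists f : {ffun 'I_k -> 'I_n}, forall a, f a = c a :> nat.
Proof.
move=> ltc; exists [ffun a : 'I_k => Ordinal (ltc a (ltn_ord a))] => a.
by rewrite ffunE.
Qed.

Lemma adjacent_run n (f : nat -> 'I_n) l :
  (forall a, a.+1 < l -> f a.+1 = (f a).+1 :> nat) ->
  forall a, a < l -> f a = f 0 + a :> nat.
Proof.
move=> E; elim=> [|a IHa] lta; first by rewrite addn0.
by rewrite E // IHa ?addnS //; apply: ltnW.
Qed.

Section Patterns.

Variables (m : nat) (sigma : 'S_m).
Hypothesis m_gt0 : 0 < m.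

Definition match_at (phi : nat -> nat) (x : nat) : bool :=
  [forall a : 'I_m, forall b : 'I_m,
     (phi (x + a) <= phi (x + b)) == (sigma a <= sigma b)].

Lemma match_atP phi x :
  reflect (forall a b : 'I_m, (phi (x + a) <= phi (x + b)) = (sigma a <= sigma b))
          (match_at phi x).
Proof.
apply: (iffP forallP) => [E a b|E a]; first by have /forallP/(_ b)/eqP := E a.
by apply/forallP => b; rewrite E.
Qed.

Lemma match_at_order n phi psi x : same_order n phi psi -> x + m <= n ->
  match_at phi x = match_at psi x.
Proof.
move=> E lex; apply: eq_forallb => a; apply: eq_forallb => b.
by have := ltn_ord a; have := ltn_ord b => lta ltb; rewrite E //; lia.
Qed.

Lemma match_at_shift d phi x :
  match_at (fun y => phi (d + y)) x = match_at phi (d + x).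
Proof.
by apply: eq_forallb => a; apply: eq_forallb => b; rewrite !addnA.
Qed.

Definition avoids_cons n (phi : nat -> nat) : bool :=
  [forall x : 'I_n, ~~ ((x + m <= n) && match_at phi x)].

Lemma avoids_consP n phi :
  reflect (forall x, x + m <= n -> ~~ match_at phi x) (avoids_cons n phi).
Proof.
apply: (iffP forallP) => [E x lex|E x].
  (* Since [0 < m], a window inside the word starts below [n], so quantifying over ['I_n] misses
     none. *)
  have ltx : x < n by lia.
  by have := E (Ordinal ltx); rewrite lex.
by apply/negP => /andP[/E/negP].
Qed.

(** Here [x] is the start of the underlined block and [l] the position of the final, largest
    letter. *)
Definition avoids_quasi n (phi : nat -> nat) : bool :=
  [forall x : 'I_n, forall l : 'I_n,
     ~~ [&& x + m <= l, match_at phi x & [forall a : 'I_m, phi (x + a) < phi l]]].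

Lemma avoids_quasiP n phi :
  reflect (forall x l, l < n -> x + m <= l -> match_at phi x ->
             exists a : 'I_m, phi l <= phi (x + a))
          (avoids_quasi n phi).
Proof.
apply: (iffP forallP) => [E x l ltl lex mx|E x].
  have ltx : x < n by lia.
  have /forallP/(_ (Ordinal ltl)) := E (Ordinal ltx).
  rewrite /= lex mx /= negb_forall => /existsP[a].
  by rewrite -leqNgt; exists a.
apply/forallP => l; apply/negP => /and3P[lex mx /forallP lt].
by have [//|a] := E x l _ lex mx; rewrite leqNgt lt.
Qed.

Lemma avoids_cons_order n : order_invariant n (avoids_cons n).
Proof.
move=> phi psi E; apply: eq_forallb => x.
by case: leqP => //= lex; rewrite (match_at_order E lex).
Qed.

Lemma avoids_quasi_order n : order_invariant n (avoids_quasi n).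
Proof.
move=> phi psi E; apply: eq_forallb => x; apply: eq_forallb => l.
case: leqP => //= lex; have ltl := ltn_ord l.
rewrite (match_at_order E (leq_trans lex (ltnW ltl))); congr (~~ (_ && _)).
by apply: eq_forallb => a; rewrite !ltnNge E //; have := ltn_ord a; lia.
Qed.

(** The letter at [i] completes any match to its left, so the left part must avoid [sigma] itself.
    Conversely, a match through [i] cannot be followed by a larger letter, so the remaining matches
    lie to the right of [i]. *)
Lemma avoids_quasi_peak i j phi : peak_at i (i + j.+1) phi ->
  avoids_quasi (i + j.+1) phi =
  avoids_cons i phi && avoids_quasi j (fun y => phi (i.+1 + y)).
Proof.
move=> peak; apply/avoids_quasiP/andP => [av|[/avoids_consP av1 /avoids_quasiP av2]].
  split.
    apply/avoids_consP => x lex; apply/negP => mx.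
    have [|a] := av x i _ lex mx; first by lia.
    by have := ltn_ord a => lta; rewrite leqNgt peak //; lia.
  apply/avoids_quasiP => x l ltl lex; rewrite match_at_shift => mx.
  have [||a] := av (i.+1 + x) (i.+1 + l) _ _ mx; [by lia|by lia|].
  by rewrite -addnA; exists a.
move=> x l ltl lex mx.
case: (leqP l i) => [leli|ltil].
  by have := av1 x (leq_trans lex leli); rewrite mx.
case: (leqP (x + m) i) => [lei|ltim]; first by have := av1 x lei; rewrite mx.
(* A match at x covering position i contains the maximal letter. *)
case: (leqP x i) => [lexi|ltix].
  have lta : i - x < m by lia.
  exists (Ordinal lta); rewrite /= subnKC //.
  by rewrite ltnW // peak //; lia.
have [|||a] := av2 (x - i.+1) (l - i.+1).
- by lia.
- by lia.
- by rewrite match_at_shift subnKC.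
by rewrite addnA !subnKC //; exists a.
Qed.

Lemma avoiders_consecutive n (s : 'S_n) :
  (s \in avoiders n (consecutive_pattern sigma)) = avoids_cons n (word s).
Proof.
rewrite inE; apply/existsPn/avoids_consP => [av x lex|av f].
  have [a lta|f fE] := @exists_ffun m n (addn x); first by lia.
  apply: contra (av f) => /match_atP mx; apply/and3P; split.
  - apply/forallP => a; apply/forallP => b; apply/implyP => ltab.
    by rewrite !fE ltn_add2l.
  - by apply/std_oneline => a b; rewrite -mx -!fE !word_val.
  - apply/forall_inP => a _; apply/forallP => b; apply/implyP => /eqP ba.
    by rewrite !fE ba addnS.
apply/negP => /and3P[_ /std_oneline ord /forall_inP adj].
(* Indexing by [nat] lets adjacency propagate by induction from [f (g 0)]; the default of [insubd]
   is irrelevant below [m]. *)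
pose g a : 'I_m := insubd (Ordinal m_gt0) a.
have gE a : a < m -> g a = a :> nat by move=> lta; rewrite val_insubd lta.
have fE (a : 'I_m) : f a = f (g 0) + a :> nat.
  rewrite -{1}[a](valKd (Ordinal m_gt0)) -/(g a).
  apply: (adjacent_run (f := f \o g) (l := m)) => //= b ltb.
  have /forallP/(_ (g b.+1))/implyP := adj (g b) (in_setT _).
  by rewrite !gE ?eqxx //; [move/(_ isT)/eqP | lia].
have le : f (g 0) + m <= n.
  by have := ltn_ord (f (g m.-1)); rewrite fE gE; lia.
by have /negP := av _ le; apply; apply/match_atP => a b; rewrite -!fE !word_val.
Qed.

Lemma avoiders_quasi n (s : 'S_n) :
  (s \in avoiders n (quasi_consecutive_pattern sigma)) =
  avoids_quasi n (word s).
Proof.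
have liftE (a : 'I_m) : lift ord_max a = a :> nat.
  by rewrite /= /bump leqNgt ltn_ord.
have permE (a b : 'I_m) :
    (lift_perm ord_max ord_max sigma (lift ord_max a) <=
     lift_perm ord_max ord_max sigma (lift ord_max b)) = (sigma a <= sigma b).
  by rewrite !lift_perm_lift /= /bump ![m <= _]leqNgt !ltn_ord.
rewrite inE; apply/existsPn/avoids_quasiP => [av x l ltl lex mx|av f].
  (* The candidate occurrence places the block at [x] and the last letter at [l]. *)
  have [a lta|f fE'] := @exists_ffun m.+1 n (fun a => if a < m then x + a else l).
    by case: ifP => // ltam; lia.
  have fl : f ord_max = l :> nat by rewrite fE' ltnn.
  have fE (a : 'I_m) : f (lift ord_max a) = x + a :> nat by rewrite fE' liftE ltn_ord.
  apply/existsP; apply: contraR (av f); rewrite negb_exists => /forallP lt.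
  move/match_atP: mx => mx.
  apply/and3P; split.
  - apply/forallP => a; apply/forallP => b; apply/implyP.
    case: (unliftP ord_max a) => [a'|] ->; case: (unliftP ord_max b) => [b'|] ->.
    + by rewrite !liftE !fE ltn_add2l.
    + by move=> _; rewrite fE fl; have /= := ltn_ord a'; lia.
    + by rewrite liftE ltnNge ltnW.
    + by rewrite ltnn.
  - apply/std_oneline => a b; rewrite -!(word_val s) [vp_perm _]/=.
    case: (unliftP ord_max a) => [a'|] ->; case: (unliftP ord_max b) => [b'|] ->.
    + by rewrite !fE mx permE.
    + rewrite lift_perm_id leq_ord fE fl; have := lt a'; rewrite -ltnNge.
      exact: ltnW.
    + rewrite lift_perm_id lift_perm_lift fE fl (negbTE (lt b')).
      by rewrite liftE leqNgt ltn_ord.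
    + by rewrite !leqnn.
  (* The underlined set stops before [m.-1], so adjacency never binds the last letter. *)
  - apply/forall_inP => a; rewrite inE => lta; apply/forallP => b.
    apply/implyP => /eqP ba; move: lta ba.
    case: (unliftP ord_max a) => [a'|] ->; case: (unliftP ord_max b) => [b'|] ->.
    + by move=> _; rewrite !liftE !fE => ->; rewrite addnS.
    + by rewrite liftE /= => lta ba; move: lta; rewrite -ba ltnn.
    + by rewrite /= ltnNge leqW.
    + by rewrite /= ltnNge leqW.
apply/negP => /and3P[/forallP inc /std_oneline ord /forall_inP adj].
pose g a : 'I_m.+1 := inord a.
have gE a : a <= m -> g a = a :> nat by move=> lta; rewrite inordK.
have gL (a : 'I_m) : g a = lift ord_max a.
  by apply: val_inj; rewrite [RHS]liftE [LHS]gE // ltnW.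
have fE a : a < m -> f (g a) = f (g 0) + a :> nat.
  move: a; apply: (adjacent_run (f := f \o g)) => b ltb /=.
  have := adj (g b); rewrite inE gE ?ltb; last by lia.
  move=> /(_ isT)/forallP/(_ (g b.+1))/implyP.
  by rewrite !gE ?eqxx //; [move/(_ isT)/eqP | exact: ltnW].
(* As [f] is increasing, its last value exceeds the end [f (g 0) + m.-1] of the block. *)
have le : f (g 0) + m <= f ord_max.
  have /forallP/(_ ord_max)/implyP := inc (g m.-1).
  by rewrite [X in X < f ord_max]fE ?gE /=; lia.
have [|a] := av _ _ (ltn_ord (f ord_max)) le.
  apply/match_atP => a b; rewrite -!fE // !word_val !gL -permE.
  by rewrite -ord.
have := ord ord_max (lift ord_max a); rewrite lift_perm_id lift_perm_lift.
by rewrite -fE // !word_val gL liftE [RHS]leqNgt ltn_ord => ->.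
Qed.

(** * Recurrence for the descent polynomials *)

Local Open Scope ring_scope.

Definition weight (R : nzRingType) (av : nat -> (nat -> nat) -> bool) (x : R) n phi : R :=
  if av n phi then x ^+ word_des n phi else 0.

Lemma weight_order (R : nzRingType) av (x : R) n : order_invariant n (av n) ->
  order_invariant n (weight av x n).
Proof.
by move=> inv phi psi E; rewrite /weight (inv _ _ E) (word_des_order E).
Qed.

Lemma A_poly_weight k (w : vpattern k) av n :
  (forall s : 'S_n, (s \in avoiders n w) = av n (word s)) ->
  A_poly w n = \sum_(s : 'S_n) weight av 'X n (word s).
Proof.
move=> E; rewrite /A_poly big_mkcond /=; apply: eq_bigr => s _.
by rewrite E /weight des_word.
Qed.

Lemma A_poly_quasi_rec n :
  A_poly (quasi_consecutive_pattern sigma) n.+1 =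
  \sum_(i < n.+1) \sum_(s : 'S_n.+1 | s i == ord_max)
     weight (avoids_cons) 'X i (word s) * 'X^(i < n) *
     weight (avoids_quasi) 'X (n - i) (fun y => word s (i.+1 + y)%N).
Proof.
rewrite (A_poly_weight (av := avoids_quasi)); last exact: avoiders_quasi.
(* The permutations are classified by the position [i] of their largest letter. *)
rewrite (partition_big (fun s : 'S_n.+1 => (s^-1)%g ord_max) predT) //=.
apply: eq_bigr => i _; apply: eq_big => [s|s /eqP si].
  by rewrite (can2_eq (permKV s) (permK s)) eq_sym.
have peak : peak_at i (i + (n - i).+1) (word s).
  have -> : (i + (n - i).+1 = n.+1)%N by have := ltn_ord i; lia.
  move=> x ltx neq; rewrite (word_val s i) -si permKV (wordE s ltx) ltn_neqAle leq_ord andbT.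
  apply/negP => /eqP E; apply: neq; rewrite -si.
  rewrite -(_ : Ordinal ltx = (s^-1)%g ord_max) //.
  by apply: (canRL (permK s)); apply: val_inj.
have := avoids_quasi_peak peak; have := word_des_peak peak.
have -> : (i + (n - i).+1 = n.+1)%N by have := ltn_ord i; lia.
rewrite /weight subn_gt0 => -> ->; case: avoids_cons => /=; last by rewrite !mul0r.
by case: avoids_quasi; rewrite ?mulr0 // -!exprD.
Qed.

(** After multiplication by the nonzero factor [i! (n - i)!], the binomial coefficient becomes [n!]
    and each inner sum is evaluated by [sum_split] with the largest letter at [i]. *)
Lemma A_poly_quasi_conv n :
  A_poly (quasi_consecutive_pattern sigma) n.+1 =
  \sum_(i < n.+1) ('X^(i < n) * A_poly (consecutive_pattern sigma) i *
    A_poly (quasi_consecutive_pattern sigma) (n - i)) *+ 'C(n, i).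
Proof.
rewrite A_poly_quasi_rec; apply: eq_bigr => i _.
have nz : ((i`! * (n - i)`!)%:R : {poly rat}) != 0.
  by rewrite -polyC_natr polyC_eq0 Num.Theory.pnatr_eq0 muln_eq0 negb_or -!lt0n !fact_gt0.
apply: (mulIf nz); rewrite !mulr_natr -mulrnA bin_fact; last by rewrite -ltnS.
have def_n : (n = i + (n - i))%N by have := ltn_ord i; lia.
rewrite (A_poly_weight (av := avoids_cons)); last exact: avoiders_consecutive.
rewrite (A_poly_weight (av := avoids_quasi)); last exact: avoiders_quasi.
have invc := @weight_order {poly rat} _ 'X _ (@avoids_cons_order i).
have invq := @weight_order {poly rat} _ 'X _ (@avoids_quasi_order (n - i)%N).
rewrite -[X in _ = X *+ _]mulrA -mulrnAr -(sum_split ord_max def_n invc invq) mulrnAr.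
rewrite mulr_sumr; congr (_ *+ _); apply: eq_bigr => s _.
by rewrite mulrCA mulrA.
Qed.

End Patterns.

(** * The exponential of a power series *)

Local Open Scope ring_scope.

Section Exp.

Variable K : fieldType.

(** Passing to polynomials makes their product and derivative rules available for coefficients up to
    [N]. *)
Definition truncation (f : fps K) N : {poly K} := \poly_(i < N.+1) f i.

Lemma coef_truncation f N i : (i <= N)%N -> (truncation f N)`_i = f i.
Proof. by move=> leiN; rewrite coef_poly ltnS leiN. Qed.

Lemma fps_pow_truncation f N m n : (n <= N)%N ->
  fps_pow f m n = (truncation f N ^+ m)`_n.
Proof.
elim: m n => [|m IHm] n len; first by rewrite expr0 coef1; case: n len.
rewrite exprS coefM /fps_pow iterS; apply: eq_bigr => i _.
rewrite coef_truncation; last by have := ltn_ord i; lia.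
by congr (_ * _); apply: IHm; have := ltn_ord i; lia.
Qed.

Lemma fps_pow_low f m n : f 0%N = 0 -> (n < m)%N -> @fps_pow K f m n = 0.
Proof.
move=> f0; elim: m n => // m IHm n ltnm.
rewrite /fps_pow iterS {1}/fps_mul big1 // => -[[|i] lti] _ /=; first by rewrite f0 mul0r.
by rewrite [iter _ _ _ _]IHm ?mulr0 //=; lia.
Qed.

Lemma fps_exp0 (f : fps K) : fps_exp f 0 = 1.
Proof. by rewrite /fps_exp big_ord1 divr1. Qed.

(** The added powers have order above [n]. A bound common to all coefficients is needed to exchange
    sums. *)
Lemma fps_exp_widen (f : fps K) n N : f 0%N = 0 -> (n <= N)%N ->
  \sum_(m < N.+1) fps_pow f m n / m`!%:R = fps_exp f n.
Proof.
move=> f0 lenN; pose g m := fps_pow f m n / m`!%:R.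
rewrite /fps_exp (big_ord_widen _ g (_ : n.+1 <= N.+1)%N) //.
rewrite [RHS]big_mkcond /=; apply: eq_bigr => m _; case: ltnP => // ltnm.
by rewrite fps_pow_low ?mul0r.
Qed.

(** Differentiating [P ^+ m.+1] gives [m.+1] times [P' P ^+ m], and the factor cancels against
    [m.+1!]; this is [(exp f)' = f' exp f] read off coefficientwise. *)
Lemma fps_exp_rec (f : fps K) n : f 0%N = 0 -> [pchar K] =i pred0 ->
  fps_exp f n.+1 *+ n.+1 =
  \sum_(i < n.+1) (f i.+1 *+ i.+1) * fps_exp f (n - i)%N.
Proof.
move=> f0 /pcharf0P K0; set P := truncation f n.+1.
have PE m l : (l <= n.+1)%N -> fps_pow f m l = (P ^+ m)`_l.
  exact: fps_pow_truncation.
rewrite /fps_exp big_ord_recl /= mul0r add0r -sumrMnl.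
transitivity (\sum_(m < n.+1) (P^`() * P ^+ m)`_n / m`!%:R).
  apply: eq_bigr => m _; have -> : fps_mul f (fps_pow f (0 + m)) n.+1 = (P ^+ m.+1)`_n.+1.
    exact: (PE m.+1).
  rewrite -mulrnAl -coef_deriv deriv_exp.
  rewrite coefMn /bump /= add1n factS natrM invfM -[X in X * _]mulr_natr.
  by rewrite mulrA mulfK // K0.
transitivity (\sum_(m < n.+1) \sum_(i < n.+1)
    (f i.+1 *+ i.+1) * (fps_pow f m (n - i)%N / m`!%:R)).
  apply: eq_bigr => m _; rewrite coefM mulr_suml; apply: eq_bigr => i _.
  rewrite coef_deriv coef_truncation; last exact: ltn_ord.
  by rewrite -PE ?mulrA //; lia.
rewrite exchange_big; apply: eq_bigr => i _ /=.
by rewrite -mulr_sumr fps_exp_widen ?leq_subr.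
Qed.

End Exp.

(** * Comparing the generating functions over [Qt] *)

Lemma bin_div_fact (K : fieldType) n i : [pchar K] =i pred0 -> (i <= n)%N ->
  'C(n, i)%:R / n`!%:R = i`!%:R^-1 * (n - i)`!%:R^-1 :> K.
Proof.
move=> /pcharf0P K0 lein; have fact_neq0 m : m`!%:R != 0 :> K.
  by rewrite K0 -lt0n fact_gt0.
rewrite -invfM -natrM; apply: (canLR (mulfK (fact_neq0 n))).
by rewrite -(bin_fact lein) [('C(n, i) * _)%:R]natrM [RHS]mulrC mulfK // natrM mulf_neq0.
Qed.

Lemma Qt_char0 : [pchar Qt] =i pred0.
Proof.
apply/pcharf0P => n; rewrite -(rmorph_nat (@tofrac {poly rat})) tofrac_eq0.
by rewrite -polyC_natr polyC_eq0 Num.Theory.pnatr_eq0.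
Qed.

Theorem theorem1p2 (k : nat) (hk : (2 <= k)%N) (sigma : 'S_(k.-1)) :
  A_series (quasi_consecutive_pattern sigma) =1
  fps_add
    (fps_scale t^-1
       (fps_sub
          (fps_exp (fps_scale t (fps_int (A_series (consecutive_pattern sigma)))))
          (fps_const 1)))
    (fps_const 1).
Proof.
have m_gt0 : (0 < k.-1)%N by lia.
have /pcharf0P char0 := Qt_char0.
have t_neq0 : t != 0 by rewrite tofrac_eq0 polyX_eq0.
set F := A_series (quasi_consecutive_pattern sigma).
set G := A_series (consecutive_pattern sigma).
set H := fps_scale t (fps_int G); set E := fps_exp H.
have H0 : H 0%N = 0 by rewrite /H /fps_scale mulr0.
(* Coefficient form of [H' = t G]. *)
have HS n : H n.+1 *+ n.+1 = t * G n.
  by rewrite /H /fps_scale /= -[LHS]mulr_natr -mulrA divfK ?char0.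
have F0 : F 0%N = 1 by rewrite /F /A_series A_poly0 // tofrac1 divr1.
(* Coefficient form of [F' = G (1 + t (F - 1))]: the factor [t] is missing exactly at [i = n], where
   [F] contributes its constant term. *)
have FS n : F n.+1 *+ n.+1 = \sum_(i < n.+1) t ^+ (i < n) * G i * F (n - i)%N.
  rewrite /F /A_series A_poly_quasi_conv // factS natrM invfM.
  rewrite -[LHS]mulr_natr mulrA [LHS]mulrAC divfK ?char0 // rmorph_sum mulr_suml.
  apply: eq_bigr => i _ /=.
  rewrite tofracMn !tofracM tofracXn -[X in X / _]mulr_natr -[LHS]mulrA.
  by rewrite (bin_div_fact Qt_char0 (leq_ord i)) mulrACA !mulrA.
move=> n; rewrite /fps_add /fps_scale /fps_sub.
elim/ltn_ind: n => -[|n] IHn.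
  by rewrite F0 /E fps_exp0 subrr mulr0 add0r.
rewrite subr0 addr0; apply: (mulIf (_ : n.+1%:R != 0)); first by rewrite char0.
rewrite -[RHS]mulrA [LHS]mulr_natr FS [in RHS]mulr_natr (fps_exp_rec _ H0 Qt_char0).
rewrite mulr_sumr; apply: eq_bigr => i _.
(* For [i < n] the index [n - i] is positive, so the induction hypothesis reads [F = t^-1 E] there,
   without constant terms. For [i = n] both [F] and [E] contribute 1, and [t^-1] cancels the factor
   [t] of [H']. *)
rewrite HS; case: ltnP => [ltin|lein].
  rewrite IHn; last by lia.
  have -> : (n - i = (n - i).-1.+1)%N by lia.
  by rewrite /= subr0 addr0 expr1 mulrCA.
have -> : (n - i = 0)%N by lia.
by rewrite F0 fps_exp0 expr0 mul1r !mulr1 mulKf.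
Qed.
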